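(* Let $\Lambda=(V,E)$ be a region of $\mathbb L^d$, let $\lambda\in\Theta$ and $\delta=2d$. Let $a_i\in(0,1)$, $p_i\in[0,1)$ and $q_i\in[1,2]$ for $i=1,2$, and write $\Phi_i=\Phi^\lambda_{\Lambda,a_i,p_i,q_i}$. Each of the following is a sufficient condition for the stochastic inequality $\Phi_1\le_{\rm st}\Phi_2$: (i) $a_1\le a_2$, $p_1\le p_2$ and $q_1=q_2$; (ii) $$q_2\Big(\frac{a_2}{1-a_2}\Big)\ge q_1\Big(\frac{a_1}{1-a_1}\Big)(1-p_1)^{-\delta/2};$$ (iii) $p_1\le p_2$, $q_1\ge q_2$, and $$q_2\Big(\frac{a_2}{1-a_2}\Big)(1-p_2)^{\delta/2}\ge q_1\Big(\frac{a_1}{1-a_1}\Big)(1-p_1)^{\delta/2};$$ (iv) $q_1\le q_2$, $$q_2\Big(\frac{a_2}{1-a_2}\Big)(1-p_2)^{\delta/2}\ge q_1\Big(\frac{a_1}{1-a_1}\Big)(1-p_1)^{\delta/2},\qquad\text{and}\qquad \frac{p_2}{q_2(1-p_2)}\ge\frac{p_1}{q_1(1-p_1)}.$$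
   Context: Let $d\ge2$ and let $\mathbb L^d=(\mathbb Z^d,\mathbb E^d)$ be the hypercubic lattice, where $\mathbb E^d$ is the set of unordered pairs $\langle x,y\rangle$ with $\sum_i|x_i-y_i|=1$. A region is a pair $\Lambda=(V,E)$ where $V\subset\mathbb Z^d$ is finite and $E$ is the set of all edges of $\mathbb E^d$ with at least one endvertex in $V$. Let $\Lambda^+=(V^+,E)$ be the subgraph of $\mathbb L^d$ induced by the edge-set $E$ (so $V^+$ consists of the endvertices of edges in $E$). Let $\Psi=\{0,1\}^{\mathbb Z^d}$, $\Omega=\{0,1\}^{\mathbb E^d}$. For $\psi\in\Psi$, $\omega\in\Omega$ let $\mathbb Z^d_\psi=\{x:\psi_x=1\}$, $\mathbb E^d_\psi=\{\langle x,y\rangle\in\mathbb E^d:\psi_x=\psi_y=1\}$ and $\eta(\omega)=\{e:\omega_e=1\}$. Let $\Theta$ be the set of $(\psi,\omega)\in\Psi\times\Omega$ with $\eta(\omega)\subseteq\mathbb E^d_\psi$. For $\lambda=(\kappa,\rho)\in\Theta$ let $\Theta^\lambda_\Lambda$ be the set of $(\psi,\omega)\in\Theta$ with $\psi_x=\kappa_x$ for $x\notin V$ and $\omega_e=\rho_e$ for $e\notin E$. With $r=\sqrt{1-p}$, the diluted-random-cluster measure on $\Lambda$ with boundary condition $\lambda$ is $$\phi^\lambda_{\Lambda,a,p,q}(\theta)=\frac1Z\,r^{|E_\psi|}q^{k(\theta,\Lambda)}\prod_{x\in V}\Big(\frac a{1-a}\Big)^{\psi_x}\prod_{e\in E_\psi}\Big(\frac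 p{1-p}\Big)^{\omega_e},\qquad\theta=(\psi,\omega)\in\Theta^\lambda_\Lambda,$$ and $0$ otherwise, where $E_\psi=\{\langle x,y\rangle\in E:\psi_x=\psi_y=1\}$, $k(\theta,\Lambda)$ is the number of connected components of $(\mathbb Z^d_\psi,\eta(\omega))$ that intersect $V^+$, and $Z$ is the normalizing constant. It is effectively supported on $\{0,1\}^V\times\{0,1\}^E$, and $\Phi^\lambda_{\Lambda,a,p,q}$ denotes its marginal on $\{0,1\}^V$. For probability measures $\mu_1,\mu_2$ on $\{0,1\}^I$, with the coordinatewise partial order, $\mu_1\le_{\rm st}\mu_2$ means $\mu_1(f)\le\mu_2(f)$ for all increasing functions $f:\{0,1\}^I\to\mathbb R$, where $\mu(f)$ denotes expectation. *)

(* Defs.v *)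
From HB Require Import structures.
From mathcomp Require Import all_boot all_order all_algebra finmap.
From mathcomp Require Import boolp classical_sets functions cardinality fsbigop.
From mathcomp Require Import reals exp.

Set Implicit Arguments.
Unset Strict Implicit.
Unset Printing Implicit Defensive.

Import Order.TTheory GRing.Theory Num.Theory.

Local Open Scope classical_set_scope.
Local Open Scope ring_scope.

Definition vertex (d : nat) : choiceType := {ffun 'I_d -> int}.

Definition adjacent (d : nat) (x y : vertex d) : Prop :=
  \sum_(i < d) `|x i - y i| = 1.

Definition is_edge (d : nat) (e : {fset vertex d}) : bool :=
  `[< exists x y : vertex d, adjacent x y /\ e = [fset x; y]%fset >].

Definition edge (d : nat) : choiceType := {e : {fset vertex d} | is_edge e}.

Definition ends (d : nat) (e : edge d) : {fset vertex d} := sval e.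

(* A pair (psi, omega) in {0,1}^(Z^d) x {0,1}^(E^d). *)
Definition config (d : nat) : choiceType :=
  ((vertex d -> bool) * (edge d -> bool))%type.

Section Lattice.
Variable d : nat.
Implicit Types (V : {fset vertex d}) (x y : vertex d) (e : edge d).
Implicit Types (theta lambda : config d).

(* The region with vertex set V is (V, region_edges V); region_edges_finite
   and mem_region_edges below show that fset_set does not take its default
   value here. *)
Definition region_edges V : {fset edge d} :=
  fset_set [set e : edge d | exists2 x, x \in V & x \in ends e].

Definition region_plus V : {fset vertex d} :=
  (\bigcup_(e <- region_edges V) ends e)%fset.

Definition edge_in (psi : vertex d -> bool) e : Prop :=
  forall x, x \in ends e -> psi x.

Definition Theta : set (config d) :=
  [set theta : config d | forall e, theta.2 e -> edge_in theta.1 e].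

Definition Theta_bc V lambda : set (config d) :=
  [set theta : config d | [/\ Theta theta,
    forall x, x \notin V -> theta.1 x = lambda.1 x &
    forall e, e \notin region_edges V -> theta.2 e = lambda.2 e]].

Definition open_step theta x y : bool :=
  `[< exists2 e, ends e = [fset x; y]%fset & theta.2 e >].

Definition connected theta x y : Prop :=
  exists2 s : seq (vertex d), path (open_step theta) x s & last x s = y.

(* Connected components of the graph (Z^d_psi, eta(omega)); for theta in Theta,
   a path of open edges from a vertex of Z^d_psi never leaves Z^d_psi. *)
Definition components theta : set (set (vertex d)) :=
  [set C | exists2 x, theta.1 x & C = [set y | connected theta x y]].

Definition components_meeting V theta : set (set (vertex d)) :=
  [set C | components theta C /\ C `&` [set` region_plus V] !=set0].

Definition num_components V theta : nat :=
  #|` fset_set (components_meeting V theta)|.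

Definition open_region_edges V (psi : vertex d -> bool) : {fset edge d} :=
  [fset e in region_edges V | `[< edge_in psi e >]]%fset.

Section Measure.
Variable R : realType.
Implicit Types a p q : R.

Definition weight V a p q theta : R :=
  Num.sqrt (1 - p) ^+ #|` open_region_edges V theta.1|
  * q ^+ num_components V theta
  * (\prod_(x <- V) (a / (1 - a)) ^+ theta.1 x)
  * (\prod_(e <- open_region_edges V theta.1) (p / (1 - p)) ^+ theta.2 e).

Definition partition_function V lambda a p q : R :=
  \sum_(theta \in Theta_bc V lambda) weight V a p q theta.

(* Probability mass function of the diluted-random-cluster measure. *)
Definition drc V lambda a p q theta : R :=
  if theta \in Theta_bc V lambda
  then weight V a p q theta / partition_function V lambda a p q
  else 0.

(* Probability mass function of the marginal of drc on {0,1}^V. *)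
Definition drc_marginal V lambda a p q (sigma : {ffun V -> bool}) : R :=
  \sum_(theta \in [set theta : config d |
                    forall x : V, theta.1 (val x) = sigma x])
     drc V lambda a p q theta.

End Measure.
End Lattice.

Arguments Theta {d}.
Arguments drc_marginal {d R} V lambda a p q sigma.

Section StochasticOrder.
Variables (R : realType) (I : finType).

Definition increasing (f : {ffun I -> bool} -> R) : Prop :=
  forall s t : {ffun I -> bool}, (forall i, s i -> t i) -> f s <= f t.

Definition expectation (mu f : {ffun I -> bool} -> R) : R :=
  \sum_s mu s * f s.

(* mu1 and mu2 are probability mass functions. *)
Definition stoch_le (mu1 mu2 : {ffun I -> bool} -> R) : Prop :=
  forall f, increasing f -> expectation mu1 f <= expectation mu2 f.

End StochasticOrder.

Section Finiteness.
Variable d : nat.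
Implicit Types (V : {fset vertex d}) (x y : vertex d) (e : edge d).

Lemma adjacentC x y : adjacent x y -> adjacent y x.
Proof. by rewrite /adjacent => <-; apply: eq_bigr => i _; rewrite distrC. Qed.

Lemma adjacent_coord_le x y (i : 'I_d) : adjacent x y -> `|y i - x i| <= 1.
Proof.
move=> /adjacentC <-; rewrite (bigD1 i)//= lerDl.
by apply: sumr_ge0 => j _; exact: normr_ge0.
Qed.

Lemma finite_neighbours x : finite_set [set y | adjacent x y].
Proof.
pose g (t : {ffun 'I_d -> 'I_3}) : vertex d :=
  [ffun i => x i + ((t i)%:Z - 1)].
apply: (@sub_finite_set _ _ (range g)); last exact/finite_image/finite_finset.
move=> y xy; exists [ffun i => inord (absz (y i - x i + 1)%R)] => //.
apply/ffunP => i; rewrite !ffunE.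
have := adjacent_coord_le i xy; rewrite ler_norml => /andP[h1 h2].
have h0 : 0 <= y i - x i + 1 by rewrite -lerBlDr sub0r.
rewrite inordK.
  by rewrite gez0_abs// addrK addrC subrK.
by rewrite -ltz_nat gez0_abs// -[X in _ < X]/(2 + 1 : int) ltzD1 -lerBrDr.
Qed.

Lemma region_edges_finite V :
  finite_set [set e : edge d | exists2 x, x \in V & x \in ends e].
Proof.
pose A : set (vertex d) := \bigcup_(x in [set` V]) [set y | adjacent x y].
have Afin : finite_set A.
  by apply: bigcup_finite => [|x _]; [exact: finite_fset|
     exact: finite_neighbours].
have Bfin : finite_set [set [fset x; y]%fset | x in [set` V] & y in A].
  by apply: finite_image2 => //; exact: finite_fset.
have Cfin : finite_set (@ends d @^-1` [set [fset x; y]%fset | x in [set` V] & y in A]).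
  apply: finite_preimage Bfin => e f _ _; exact: val_inj.
apply: sub_finite_set Cfin => e /= [x xV xe].
have /asboolP[u [v [uv euv]]] := svalP e.
move: xe; rewrite /ends euv !inE => /orP[] /eqP ?; subst x.
  by exists u => //; exists v => //; exists u.
exists v => //; exists u; last by rewrite fsetUC.
by exists v => //; exact: adjacentC.
Qed.

Lemma mem_region_edges V e :
  reflect (exists2 x, x \in V & x \in ends e) (e \in region_edges V).
Proof.
by rewrite /region_edges in_fset_set ?inE; [exact: asboolP|
  exact: region_edges_finite].
Qed.

Lemma components_meeting_finite V (theta : config d) :
  finite_set (components_meeting V theta).
Proof.
apply: (@sub_finite_set _ _
  [set [set y | connected theta x y] | x in [set` region_plus V]]); last first.
  by apply: finite_image; exact: finite_fset.
have sym x y : connected theta x y -> connected theta y x.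
  case=> s p <-; exists (rev (belast x s)).
    rewrite rev_path; apply: sub_path p => u v /asboolP[e ee oe].
    by apply/asboolP; exists e => //; rewrite fsetUC.
  by case: s {p} => //= y0 s; rewrite rev_cons last_rcons.
have trans x y z : connected theta x y -> connected theta y z ->
    connected theta x z.
  case=> s ps <- [t pt <-]; exists (s ++ t); last by rewrite last_cat.
  by rewrite cat_path ps.
move=> C [[x xo ->]] [y /= [xy yV]]; exists y => //=.
apply/seteqP; split=> z /=; first exact: trans.
exact/trans/sym.
Qed.

Lemma Theta_bc_finite V (lambda : config d) : finite_set (Theta_bc V lambda).
Proof.
pose g (st : {ffun V -> bool} * {ffun region_edges V -> bool}) : config d :=
  (fun x => if insub x is Some v then st.1 v else lambda.1 x,
   fun e => if insub e is Some f then st.2 f else lambda.2 e).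
apply: (@sub_finite_set _ _ (range g)); last exact/finite_image/finite_finset.
move=> [psi omega] [_ /= hV hE].
exists ([ffun v => psi (val v)], [ffun f => omega (val f)]) => //.
congr pair; apply/funext => z; case: insubP => [w _ wz|zN] /=.
- by rewrite ffunE wz.
- by rewrite hV.
- by rewrite ffunE wz.
- by rewrite hE.
Qed.

End Finiteness.

(* Main.v *)
Require Import Defs.
From mathcomp Require Import boolp classical_sets cardinality fsbigop.
From mathcomp Require Import reals exp.
From mathcomp Require Import all_boot all_order all_algebra finmap.
From mathcomp Require Import ring lra.

(* Take all of Z^d as vertex set: each closed vertex becomes one more
   (singleton) component, so Phi(psi) is proportional to
   (q a / (1 - a))^|psi| g(E_psi), where g(A) = r^|A| Z(A) and
   Z(A) = sum_(w <= A) (p / (1 - p))^|w| q^K(w), with K(w) the number of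
   components of (Z^d, w) meeting V^+.  The function K is supermodular and drops
   by at most 1 when an edge is added.  By the Ahlswede-Daykin four functions
   theorem on edge sets, Z_1(A) Z_2(B) <= Z_1(A n B) Z_2(A u B) under the
   comparison conditions of random-cluster measures; moreover g increases for
   q <= 2 since r (1 + p / (2 (1 - p))) >= 1.  As |E_psi \ E_psi'| <=
   2d |psi \ psi'|, these facts give
   Phi_1(s) Phi_2(t) <= Phi_1(s n t) Phi_2(s u t) in all four cases, and the
   four functions theorem on vertex sets yields the stochastic inequality. *)

Set Implicit Arguments.
Unset Strict Implicit.
Unset Printing Implicit Defensive.

Import Order.TTheory GRing.Theory Num.Theory.

Local Open Scope ring_scope.

(** * The four functions theorem *)

Section FourFunctions.
Variable R : realFieldType.

(** The diagonal products are bounded by hypothesis. With [w = c0 * d1], multiplying the two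
    diagonal bounds gives [(a0 * b1) * (a1 * b0) <= w * (c1 * d0)]; together with
    [(w - a0 * b1) * (w - a1 * b0) >= 0] this bounds the cross terms after division by [w]. *)
Lemma four_functions_bool (a0 a1 b0 b1 c0 c1 d0 d1 : R) :
  0 <= a0 -> 0 <= a1 -> 0 <= b0 -> 0 <= b1 ->
  0 <= c0 -> 0 <= c1 -> 0 <= d0 -> 0 <= d1 ->
  a0 * b0 <= c0 * d0 -> a0 * b1 <= c0 * d1 ->
  a1 * b0 <= c0 * d1 -> a1 * b1 <= c1 * d1 ->
  (a0 + a1) * (b0 + b1) <= (c0 + c1) * (d0 + d1).
Proof.
move=> a0p a1p b0p b1p c0p c1p d0p d1p h00 h01 h10 h11.
suff : a0 * b1 + a1 * b0 <= c0 * d1 + c1 * d0 by lra.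
have := mulr_ge0 c0p d1p; rewrite le_eqVlt => /orP[/eqP w0|w_gt0].
  have := mulr_ge0 c1p d0p; lra.
rewrite -(ler_pM2l w_gt0).
have uv : (a0 * b0) * (a1 * b1) <= (c0 * d0) * (c1 * d1).
  by apply: ler_pM => //; apply: mulr_ge0.
have : 0 <= (c0 * d1 - a0 * b1) * (c0 * d1 - a1 * b0).
  by apply: mulr_ge0; rewrite subr_ge0.
lra.
Qed.

Lemma sum_subset_setU1 (I : finType) (f : {set I} -> R) (D : {set I}) x :
  x \in D ->
  \sum_(S : {set I} | S \subset D) f S =
  \sum_(S : {set I} | S \subset D :\ x) (f S + f (x |: S)).
Proof.
move=> xD; rewrite (bigID (fun S : {set I} => x \in S)) /= addrC big_split /=.
congr (_ + _).
  by apply: eq_bigl => S; rewrite subsetD1.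
rewrite (reindex_onto (fun S => x |: S) (fun S => S :\ x)) /=; last first.
  by move=> S /andP[_ xS]; rewrite setD1K.
apply: eq_bigl => S; rewrite subUset sub1set xD setU11 andbT /=.
rewrite subsetD1; congr (_ && _).
apply/eqP/idP => [<-|xS]; first by rewrite setD11.
by rewrite setU1K.
Qed.

(** Induction on [#|D|]: for [x] in [D], adding the values of each function at [S] and [x |: S]
    gives functions on the subsets of [D :\ x], which inherit the hypothesis by the two-point
    case. *)
Lemma four_functions (I : finType) (D : {set I}) (f g h k : {set I} -> R) :
  (forall S, 0 <= f S) -> (forall S, 0 <= g S) ->
  (forall S, 0 <= h S) -> (forall S, 0 <= k S) ->
  (forall S T : {set I}, S \subset D -> T \subset D ->
     f S * g T <= h (S :&: T) * k (S :|: T)) ->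
  (\sum_(S : {set I} | S \subset D) f S) * (\sum_(S : {set I} | S \subset D) g S)
  <= (\sum_(S : {set I} | S \subset D) h S)
     * (\sum_(S : {set I} | S \subset D) k S).
Proof.
move: {2}#|D| (erefl #|D|) => n; elim: n D f g h k => [|n IH] D f g h k.
  move/eqP; rewrite cards_eq0 => /eqP-> _ _ _ _ fghk.
  have E (F : {set I} -> R) : \sum_(S : {set I} | S \subset set0) F S = F set0.
    by under eq_bigl do rewrite subset0; rewrite big_pred1_eq.
  by rewrite !E; have := fghk set0 set0; rewrite setI0 setU0; apply.
move=> cD f0 g0 h0 k0 fghk.
have /card_gt0P[x xD] : (0 < #|D|)%N by rewrite cD.
rewrite !(sum_subset_setU1 _ xD).
apply: IH => [|S|S|S|S|S T]; try by rewrite addr_ge0.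
  by move: cD; rewrite (cardsD1 x) xD => -[].
rewrite !subsetD1 => /andP[SD xS] /andP[TD xT].
have xSD : x |: S \subset D by rewrite subUset sub1set xD.
have xTD : x |: T \subset D by rewrite subUset sub1set xD.
apply: four_functions_bool => //.
- exact: fghk.
- have := fghk _ _ SD xTD; rewrite setUCA.
  by rewrite setIC setIUl [[set x] :&: S]disjoint_setI0 ?disjoints1// set0U setIC.
- have := fghk _ _ xSD TD; rewrite -setUA.
  by rewrite setIUl [[set x] :&: T]disjoint_setI0 ?disjoints1// set0U.
- by have := fghk _ _ xSD xTD; rewrite -setUIr -setUUr.
Qed.

(** Each function is extended by zero outside its own range of summation; the hypothesis survives
    because [S :&: T] and [S :|: T] stay in range. *)
Lemma four_functions_subset (I : finType) (A B : {set I})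
    (f g h k : {set I} -> R) :
  (forall S, 0 <= f S) -> (forall S, 0 <= g S) ->
  (forall S, 0 <= h S) -> (forall S, 0 <= k S) ->
  (forall S T : {set I}, S \subset A -> T \subset B ->
     f S * g T <= h (S :&: T) * k (S :|: T)) ->
  (\sum_(S : {set I} | S \subset A) f S) * (\sum_(S : {set I} | S \subset B) g S)
  <= (\sum_(S : {set I} | S \subset A :&: B) h S)
     * (\sum_(S : {set I} | S \subset A :|: B) k S).
Proof.
move=> f0 g0 h0 k0 fghk.
pose on (C : {set I}) (F : {set I} -> R) (S : {set I}) := if S \subset C then F S else 0.
have on0 (C : {set I}) (F : {set I} -> R) : (forall S, 0 <= F S) -> forall S, 0 <= on C F S.
  by move=> F0 S; rewrite /on; case: ifP.
have onE (C : {set I}) (F : {set I} -> R) : \sum_(S : {set I} | S \subset C) F S =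
    \sum_(S : {set I} | S \subset setT) on C F S.
  by rewrite big_mkcond; apply: eq_big => // S; rewrite subsetT.
rewrite (onE A f) (onE B g) (onE (A :&: B) h) (onE (A :|: B) k).
apply: four_functions; try exact: on0.
move=> S T _ _; rewrite {1 2}/on.
have [SA|SA] := boolP (S \subset A); last by rewrite mul0r mulr_ge0 ?on0.
have [TB|TB] := boolP (T \subset B); last by rewrite mulr0 mulr_ge0 ?on0.
by rewrite /on setISS// setUSS//; exact: fghk.
Qed.

End FourFunctions.

(** * From one-point inequalities to the lattice of subsets *)

Lemma cardsU_setD (T : finType) (A B : {set T}) :
  #|A :|: B| = (#|B| + #|A :\: B|)%N.
Proof.
rewrite -(cardsID B (A :|: B)) (setIidPr (subsetUr A B)).
by rewrite setDUl setDv setU0.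
Qed.

(** Induction on [#|A :\: B|]: for [e] in [A :\: B], the inequality for [A :\ e] and [B] is
    multiplied by the one-point inequality for [A :\ e] and [(A :\ e) :|: B], and the common
    positive factor cancels. *)
Lemma one_point_lattice (R : realFieldType) (J : finType) (F G : {set J} -> R) :
  (forall A, 0 < F A) -> (forall A, 0 < G A) ->
  (forall (A B : {set J}) e, A \subset B -> e \notin B ->
     F (e |: A) * G B <= F A * G (e |: B)) ->
  forall A B : {set J}, F A * G B <= F (A :&: B) * G (A :|: B).
Proof.
move=> F0 G0 step A B.
move: {2}#|A :\: B| (erefl #|A :\: B|) => n.
elim: n A => [|n IH] A cAB.
  have /setIidPl-> : A \subset B by rewrite -setD_eq0 -cards_eq0 cAB.
  by rewrite (setUidPr _) // -setD_eq0 -cards_eq0 cAB.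
have /card_gt0P[e eAB] : (0 < #|A :\: B|)%N by rewrite cAB.
move: (eAB); rewrite inE => /andP[eB eA].
have /IH : #|(A :\ e) :\: B| = n.
  by move: cAB; rewrite setDDl setUC -setDDl (cardsD1 e) eAB => -[].
have -> : (A :\ e) :&: B = A :&: B.
  by apply/setP=> x; rewrite !inE; case: (eqVneq x e) => //= ->; rewrite (negbTE eB) andbF.
have := step (A :\ e) ((A :\ e) :|: B) e (subsetUl _ _).
rewrite !inE eqxx (negbTE eB) => /(_ isT); rewrite setUA setD1K//.
move=> h1 h2; rewrite -(ler_pM2r (mulr_gt0 (F0 (A :\ e)) (G0 ((A :\ e) :|: B)))).
have := ler_pM (ltW (mulr_gt0 (F0 _) (G0 _))) (ltW (mulr_gt0 (F0 _) (G0 _))) h1 h2.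
by congr (_ <= _); ring.
Qed.

Lemma one_point_mono (R : realFieldType) (J : finType) (F : {set J} -> R) :
  (forall A, 0 < F A) ->
  (forall (A : {set J}) e, e \notin A -> F A <= F (e |: A)) ->
  forall A B : {set J}, A \subset B -> F A <= F B.
Proof.
move=> F0 step A B /setUidPl <-.
have := @one_point_lattice R J (fun=> 1) F (fun=> ltr01) F0 _ B A.
rewrite !mul1r; apply=> C D e _ eD; rewrite !mul1r; exact: step.
Qed.

(** With [y = p / (1 - p)], the relation [r ^+ 2 * (1 + y) = 1] encodes [r = sqrt (1 - p)], so [r]
    decreases as [y] grows. *)
Lemma dilution_le (R : realFieldType) (r1 r2 y1 y2 : R) :
  0 < r1 -> 0 < r2 -> 0 <= y1 -> r1 ^+ 2 * (1 + y1) = 1 ->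
  r2 ^+ 2 * (1 + y2) = 1 -> y1 <= y2 -> r2 <= r1.
Proof.
move=> r10 r20 y10 ry1 ry2 y12; rewrite leNgt; apply/negP => r12.
have r12' : 0 < r2 ^+ 2 - r1 ^+ 2 by rewrite subr_gt0 ltrXn2r ?nnegrE ?ltW.
have := mulr_gt0 r12' (ltr_wpDr y10 ltr01).
have : 0 <= r2 ^+ 2 * (y2 - y1) by rewrite mulr_ge0 ?sqr_ge0// subr_ge0.
lra.
Qed.

(** * Random-cluster weights *)

Section EdgeWeights.
Variables (R : realFieldType) (J : finType) (K : {set J} -> nat).
Implicit Types (S T A B : {set J}) (e : J) (r y q : R).
(** The graph enters only through these three properties of the cluster count [K]; the last one says
    that an added edge lowers [K] less on a larger edge set. *)
Hypothesis K_anti : forall S e, (K (e |: S) <= K S)%N.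
Hypothesis K_drop : forall S e, (K S <= (K (e |: S)).+1)%N.
Hypothesis K_step : forall (S T : {set J}) e,
  S \subset T -> (K (e |: S) + K T <= K S + K (e |: T))%N.

(** Passing to [2 ^+ K] makes [K_step] multiplicative, so that [one_point_lattice] applies. *)
Lemma K_supermodular (S T : {set J}) : (K S + K T <= K (S :&: T) + K (S :|: T))%N.
Proof.
have p0 (A : {set J}) : 0 < 2 ^+ K A :> R by rewrite exprn_gt0.
have := @one_point_lattice R J (fun A => 2 ^+ K A) (fun A => 2 ^+ K A) p0 p0 _ S T.
rewrite -!exprD ler_eXn2l ?ltr1n//; apply=> A B e AB _.
by rewrite -!exprD ler_weXn2l ?ler1n// K_step.
Qed.

Lemma K_mono (S T : {set J}) : S \subset T -> (K T <= K S)%N.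
Proof.
move=> ST; have := @one_point_mono R J (fun A => (2 ^+ K A)^-1) _ _ S T ST.
rewrite lef_pV2 ?posrE ?exprn_gt0// ler_eXn2l ?ltr1n//; apply.
  by move=> A; rewrite invr_gt0 exprn_gt0.
move=> A e _; rewrite lef_pV2 ?posrE ?exprn_gt0//.
by rewrite ler_weXn2l ?ler1n.
Qed.

(** By [K_drop], [K A + #|A|] does not decrease when an edge is added. *)
Lemma K_leD (S T : {set J}) : S \subset T -> (K S <= K T + #|T :\: S|)%N.
Proof.
move=> ST; have p0 (A : {set J}) : 0 < 2 ^+ (K A + #|A|) :> R by rewrite exprn_gt0.
have := one_point_mono p0 _ ST; rewrite ler_eXn2l ?ltr1n// => H.
have cT := cardsID S T; rewrite (setIidPr ST) in cT.
rewrite -(leq_add2r #|S|) -addnA [(#|_| + #|S|)%N]addnC cT; apply: H => A e eA.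
by rewrite ler_eXn2l ?ltr1n// cardsU1 eA addnA addn1 leq_add2r.
Qed.

Definition rc_weight (y q : R) (S : {set J}) : R := y ^+ #|S| * q ^+ K S.

Definition rc_sum (y q : R) (A : {set J}) : R :=
  \sum_(S : {set J} | S \subset A) rc_weight y q S.

(** For [e] outside [A], [y] times this sum is the contribution to [rc_sum y q (e |: A)] of the sets
    that contain [e]. *)
Definition rc_sum_with (y q : R) (e : J) (A : {set J}) : R :=
  \sum_(S : {set J} | S \subset A) y ^+ #|S| * q ^+ K (e |: S).

Lemma rc_weight_ge0 y q S : 0 <= y -> 1 <= q -> 0 <= rc_weight y q S.
Proof. by move=> y0 q1; rewrite mulr_ge0 ?exprn_ge0// (le_trans _ q1). Qed.

Lemma rc_sum_gt0 y q A : 0 <= y -> 1 <= q -> 0 < rc_sum y q A.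
Proof.
move=> y0 q1; have q0 : 0 < q by exact: lt_le_trans q1.
rewrite /rc_sum (bigD1 set0) ?sub0set//= ltr_wpDr//.
  by apply: sumr_ge0 => S _; exact: rc_weight_ge0.
by rewrite /rc_weight cards0 mul1r exprn_gt0.
Qed.

Lemma rc_sum_setU1 y q e A : e \notin A ->
  rc_sum y q (e |: A) = rc_sum y q A + y * rc_sum_with y q e A.
Proof.
move=> eA; rewrite /rc_sum (sum_subset_setU1 _ (setU11 e A)) setU1K//.
rewrite big_split /=; congr (_ + _).
rewrite big_distrr /=; apply: eq_bigr => S SA.
have eS : e \notin S by apply: contra eA; exact/subsetP.
by rewrite /rc_weight cardsU1 eS exprS mulrA.
Qed.

Lemma rc_sum_with_le y q e A : 0 <= y -> 1 <= q ->
  rc_sum_with y q e A <= rc_sum y q A.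
Proof.
move=> y0 q1; apply: ler_sum => S _.
by rewrite ler_wpM2l ?exprn_ge0// ler_weXn2l.
Qed.

Lemma rc_sum_with_ge y q e A : 0 <= y -> 1 <= q ->
  rc_sum y q A <= q * rc_sum_with y q e A.
Proof.
move=> y0 q1; rewrite big_distrr /=; apply: ler_sum => S _.
by rewrite mulrCA ler_wpM2l ?exprn_ge0// -exprS ler_weXn2l.
Qed.

(** With [n = #|S :\: T|], [s = K (S :&: T) - K S] and [t = K T - K (S :|: T)], cancelling common
    factors leaves [y1 ^+ n * q2 ^+ t <= y2 ^+ n * q1 ^+ s]. Supermodularity of [K] gives
    [t <= s]. *)
Lemma rc_weight_lattice y1 y2 q1 q2 :
  0 <= y1 -> 0 <= y2 -> 1 <= q1 -> 1 <= q2 ->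
  (y1 <= y2 /\ q2 <= q1) \/ (q1 <= q2 /\ y1 / q1 <= y2 / q2) ->
  forall S T, rc_weight y1 q1 S * rc_weight y2 q2 T <=
    rc_weight y1 q1 (S :&: T) * rc_weight y2 q2 (S :|: T).
Proof.
move=> y10 y20 q11 q21 H S T.
have q10 : 0 < q1 by exact: lt_le_trans q11.
have q20 : 0 < q2 by exact: lt_le_trans q21.
have cS := cardsID T S.
have Ksup := K_supermodular S T.
have KSI : (K S <= K (S :&: T))%N by apply: K_mono; exact: subsetIl.
have KTU : (K (S :|: T) <= K T)%N by apply: K_mono; exact: subsetUr.
rewrite /rc_weight -cS cardsU_setD !exprD.
set n := #|S :\: T|.
rewrite -(subnKC KSI) -(subnKC KTU) !exprD.
set s := (_ - K S)%N; set t := (_ - K _)%N.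
have ts : (t <= s)%N.
  rewrite leq_subLR addnBA// leq_subRL ?(leq_trans KSI) ?leq_addl//.
  by rewrite [(K (S :|: T) + _)%N]addnC.
suff key : y1 ^+ n * q2 ^+ t <= y2 ^+ n * q1 ^+ s.
  set u := y1 ^+ _; set v := y2 ^+ #|T|; set w := q1 ^+ K S; set x := q2 ^+ K _.
  have uvwx : 0 <= u * v * w * x by rewrite !mulr_ge0 ?exprn_ge0// ltW.
  by have := ler_wpM2l uvwx key; congr (_ <= _); ring.
case: H => [[y12 q21']|[q12 yq]].
  apply: ler_pM; rewrite ?exprn_ge0 ?(ltW q20)//.
    by rewrite lerXn2r ?nnegrE.
  apply: (@le_trans _ _ (q1 ^+ t)); first by rewrite lerXn2r ?nnegrE// ltW.
  by rewrite ler_weXn2l.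
(* Each edge of [S :\: T] added to [T] removes at most one cluster. *)
have tn : (t <= n)%N.
  rewrite /t leq_subLR; apply: leq_trans (K_leD (subsetUr S T)) _.
  by rewrite setDUl setDv setU0.
have y12 : y1 <= y2.
  apply: le_trans (_ : y1 * (q2 / q1) <= y2).
    by rewrite ler_peMr// ler_pdivlMr// mul1r.
  by rewrite mulrCA mulrC -ler_pdivlMr.
have yq21 : y1 * q2 <= y2 * q1.
  by rewrite -ler_pdivrMr// mulrAC -ler_pdivlMr.
(* The [t] factors [q2] are paired with [t] of the [n] factors [y1]; the other [y1] are bounded by
   [y2], and the surplus [q1 ^+ (s - t)] is at least 1. *)
have -> : y1 ^+ n * q2 ^+ t = y1 ^+ (n - t) * (y1 * q2) ^+ t * 1.
  by rewrite -{1}(subnK tn) exprD exprMn; ring.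
have -> : y2 ^+ n * q1 ^+ s = y2 ^+ (n - t) * (y2 * q1) ^+ t * q1 ^+ (s - t).
  by rewrite -{1}(subnK tn) -{1}(subnK ts) !exprD exprMn; ring.
have [q10' q20'] := (ltW q10, ltW q20).
apply: ler_pM => //; rewrite ?mulr_ge0 ?exprn_ge0 ?mulr_ge0 ?exprn_ege1//.
by apply: ler_pM; rewrite ?exprn_ge0 ?mulr_ge0// lerXn2r ?nnegrE ?mulr_ge0.
Qed.

Lemma rc_sum_lattice y1 y2 q1 q2 :
  0 <= y1 -> 0 <= y2 -> 1 <= q1 -> 1 <= q2 ->
  (y1 <= y2 /\ q2 <= q1) \/ (q1 <= q2 /\ y1 / q1 <= y2 / q2) ->
  forall A B, rc_sum y1 q1 A * rc_sum y2 q2 B <=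
    rc_sum y1 q1 (A :&: B) * rc_sum y2 q2 (A :|: B).
Proof.
move=> y10 y20 q11 q21 H A B.
apply: four_functions_subset => [S|S|S|S|S T _ _]; try exact: rc_weight_ge0.
exact: rc_weight_lattice.
Qed.

(** The ratio [rc_sum_with / rc_sum] is the random-cluster mean of [q ^ (K (e |: S) - K S)], an
    increasing function of [S]; hence it grows with [y] and with the edge set. The proof is the four
    functions theorem with [K_supermodular] at [e |: S] and [T]. *)
Lemma rc_sum_with_lattice y1 y2 q : 0 <= y1 -> y1 <= y2 -> 1 <= q ->
  forall A B e, A \subset B -> e \notin B ->
  rc_sum_with y1 q e A * rc_sum y2 q B <= rc_sum y1 q A * rc_sum_with y2 q e B.
Proof.
move=> y10 y12 q1 A B e AB eB; have y20 := le_trans y10 y12.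
have q0 : 0 <= q by exact: le_trans q1.
have := @four_functions_subset R J A B (fun S => y1 ^+ #|S| * q ^+ K (e |: S))
  (rc_weight y2 q) (rc_weight y1 q) (fun S => y2 ^+ #|S| * q ^+ K (e |: S)).
rewrite (setIidPl AB) (setUidPr AB); apply => [S|S|S|S|S T _ TB];
  rewrite ?mulr_ge0 ?exprn_ge0//.
have eT : e \notin T by apply: contra eB; exact/subsetP.
have eST : (e |: S) :&: T = S :&: T.
  by apply/setP => x; rewrite !inE; case: (eqVneq x e) => //= ->; rewrite (negbTE eT) andbF.
have := K_supermodular (e |: S) T; rewrite eST -setUA => Ksup.
rewrite /rc_weight mulrACA [leRHS]mulrACA -!exprD.
apply: ler_pM; rewrite ?mulr_ge0 ?exprn_ge0//; last by rewrite ler_weXn2l.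
rewrite cardsU_setD -{1}(cardsID T S) !exprD -!mulrA ler_wpM2l ?exprn_ge0//.
by rewrite mulrC ler_wpM2l ?exprn_ge0// lerXn2r ?nnegrE.
Qed.

Definition diluted r y q A : R := r ^+ #|A| * rc_sum y q A.

Lemma diluted_gt0 r y q A : 0 < r -> 0 <= y -> 1 <= q -> 0 < diluted r y q A.
Proof. by move=> r0 y0 q1; rewrite mulr_gt0 ?exprn_gt0// rc_sum_gt0. Qed.

(* [r * (1 + y / 2) >= 1] by AM-GM, as [r * (1 + y) = 1 / r]; this is where
   [q <= 2] enters. *)
Lemma diluted_mono r y q : 0 < r -> 0 <= y -> r ^+ 2 * (1 + y) = 1 ->
  1 <= q <= 2 -> forall A B, A \subset B -> diluted r y q A <= diluted r y q B.
Proof.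
move=> r0 y0 ry /andP[q1 q2].
apply: one_point_mono => [A|A e eA]; first exact: diluted_gt0.
rewrite /diluted cardsU1 eA rc_sum_setU1// exprS -mulrA [leRHS]mulrCA.
rewrite ler_wpM2l ?exprn_ge0 ?(ltW r0)//.
have Z0 := rc_sum_gt0 A y0 q1.
have W : rc_sum y q A <= 2 * rc_sum_with y q e A.
  have W0 : 0 <= rc_sum_with y q e A.
    apply: sumr_ge0 => S _.
    by rewrite mulr_ge0 ?exprn_ge0// (le_trans _ q1).
  apply: le_trans (rc_sum_with_ge e A y0 q1) _.
  by rewrite ler_wpM2r.
have ryW := ler_wpM2l y0 W.
have key : 1 <= r * (1 + y / 2).
  rewrite -(ler_pM2l r0) mulr1.
  have : 0 <= (r - 1) ^+ 2 by exact: sqr_ge0.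
  nra.
apply: le_trans (_ : r * (1 + y / 2) * rc_sum y q A <= _).
  by rewrite ler_peMl // ltW.
rewrite -mulrA ler_wpM2l ?(ltW r0)//; lra.
Qed.

(** By [one_point_lattice] a single edge suffices, and [rc_sum_with_lattice] reduces it to [r1 * (ZB
    + y1 * WB) <= r2 * (ZB + y2 * WB)]. As [r * y = r^-1 - r], this reads [(r1 - r2) * (ZB - WB) <=
    (r1 - r2) * s * WB] with [s = (r1 * r2)^-1 >= 1], which follows from [ZB <= 2 * WB], that is
    from [q <= 2]. *)
Lemma diluted_lattice r1 r2 y1 y2 q : 0 < r1 -> 0 < r2 -> 0 <= y1 -> 0 <= y2 ->
  r1 ^+ 2 * (1 + y1) = 1 -> r2 ^+ 2 * (1 + y2) = 1 -> y1 <= y2 -> 1 <= q <= 2 ->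
  forall A B, diluted r1 y1 q A * diluted r2 y2 q B <=
    diluted r1 y1 q (A :&: B) * diluted r2 y2 q (A :|: B).
Proof.
move=> r10 r20 y10 y20 ry1 ry2 y12 /andP[q1 q2].
apply: one_point_lattice => [A|A|A B e AB eB]; try exact: diluted_gt0.
have eA : e \notin A by apply: contra eB; exact/subsetP.
rewrite /diluted !cardsU1 eA eB !rc_sum_setU1// !exprS.
have := rc_sum_with_lattice y10 y12 q1 AB eB.
have := rc_sum_with_ge e B y20 q1.
have := rc_sum_with_le e B y20 q1.
have := rc_sum_gt0 A y10 q1; have := rc_sum_gt0 B y20 q1.
set ZA := rc_sum _ _ A; set ZB := rc_sum _ _ B.
set WA := rc_sum_with _ _ _ A; set WB := rc_sum_with _ _ _ B.
move=> ZB0 ZA0 WZ ZW WZZW.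
have W0 : 0 <= WB.
  by apply: sumr_ge0 => S _; rewrite mulr_ge0 ?exprn_ge0// (le_trans _ q1).
have ZW2 : ZB <= 2 * WB by apply: le_trans ZW _; rewrite ler_wpM2r.
suff H : r1 * (ZA + y1 * WA) * ZB <= ZA * (r2 * (ZB + y2 * WB)).
  have c0 : 0 <= r1 ^+ #|A| * r2 ^+ #|B| by rewrite mulr_ge0 ?exprn_ge0 ?ltW.
  by have := ler_wpM2l c0 H; congr (_ <= _); ring.
apply: le_trans (_ : ZA * (r1 * (ZB + y1 * WB)) <= _).
  have := ler_wpM2l (mulr_ge0 (ltW r10) y10) WZZW; lra.
rewrite ler_wpM2l ?(ltW ZA0)//.
have ryE (r y : R) : 0 < r -> r ^+ 2 * (1 + y) = 1 -> r * y = r^-1 - r.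
  move=> r0 ry; apply: (mulfI (lt0r_neq0 r0)); rewrite mulrBr divff ?lt0r_neq0//.
  by rewrite -ry; ring.
have r21 := dilution_le r10 r20 y10 ry1 ry2 y12.
have r1_le1 : r1 <= 1.
  rewrite -(@expr_le1 _ 2) ?(ltW r10)//.
  have := mulr_ge0 (sqr_ge0 r1) y10; lra.
have s1 : 1 <= r1^-1 by rewrite invf_ge1.
have s2 : 1 <= r2^-1 by rewrite invf_ge1// (le_trans r21).
rewrite !mulrDr !mulrA (ryE _ _ r10 ry1) (ryE _ _ r20 ry2).
have -> : r2^-1 = r1^-1 + (r1 - r2) * (r1^-1 * r2^-1).
  by field; rewrite !lt0r_neq0.
have : 1 <= r1^-1 * r2^-1 by apply: mulr_ege1.
set s := r1^-1 * r2^-1 => s_ge1.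
have : 0 <= (r1 - r2) * (2 * WB - ZB) by rewrite mulr_ge0 ?subr_ge0.
have : 0 <= (r1 - r2) * ((s - 1) * WB) by rewrite !mulr_ge0 ?subr_ge0.
lra.
Qed.

(** An added edge multiplies the sum by at most [1 + y], so [(1 + y) ^+ #|C| / rc_sum y q C] is
    nondecreasing in [C]. *)
Lemma rc_sum_leD y q : 0 <= y -> 1 <= q -> forall A B, A \subset B ->
  rc_sum y q B <= (1 + y) ^+ #|B :\: A| * rc_sum y q A.
Proof.
move=> y0 q1 A B AB; have y1 : 0 < 1 + y by rewrite ltr_wpDr.
have F0 (C : {set J}) : 0 < (1 + y) ^+ #|C| / rc_sum y q C.
  by rewrite divr_gt0 ?exprn_gt0// rc_sum_gt0.
have := one_point_mono F0 _ AB.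
rewrite ler_pdivlMr ?rc_sum_gt0// mulrAC ler_pdivrMr ?rc_sum_gt0//.
rewrite -(cardsID A B) (setIidPr AB) exprD -mulrA ler_pM2l ?exprn_gt0//; apply.
move=> C e eC; rewrite cardsU1 eC exprS.
rewrite ler_pdivlMr ?rc_sum_gt0// mulrAC ler_pdivrMr ?rc_sum_gt0//.
rewrite -mulrA [leRHS]mulrCA ler_wpM2l ?exprn_ge0 ?(ltW y1)//.
by rewrite rc_sum_setU1// mulrDl mul1r lerD2l ler_wpM2l// rc_sum_with_le.
Qed.

(** The extra powers balance the dilution factors exactly, so this is [rc_sum_lattice] times a
    common factor. *)
Lemma diluted_lattice_rc r1 r2 y1 y2 q1 q2 : 0 < r1 -> 0 < r2 ->
  0 <= y1 -> 0 <= y2 -> 1 <= q1 -> 1 <= q2 ->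
  (y1 <= y2 /\ q2 <= q1) \/ (q1 <= q2 /\ y1 / q1 <= y2 / q2) ->
  forall A B, diluted r1 y1 q1 A * diluted r2 y2 q2 B * r2 ^+ #|A :\: B| <=
    r1 ^+ #|A :\: B| * (diluted r1 y1 q1 (A :&: B) * diluted r2 y2 q2 (A :|: B)).
Proof.
move=> r10 r20 y10 y20 q11 q21 H A B; rewrite /diluted.
rewrite cardsU_setD -{1}(cardsID B A) !exprD.
have c0 : 0 <= r1 ^+ #|A :&: B| * r1 ^+ #|A :\: B| * (r2 ^+ #|B| * r2 ^+ #|A :\: B|).
  by rewrite !mulr_ge0 ?exprn_ge0 ?ltW.
have := ler_wpM2l c0 (rc_sum_lattice y10 y20 q11 q21 H A B).
by congr (_ <= _); ring.
Qed.

(** An added edge multiplies [diluted] by at most [r * (1 + y) = r^-1]. *)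
Lemma diluted_leD r y q : 0 < r -> 0 <= y -> r ^+ 2 * (1 + y) = 1 -> 1 <= q ->
  forall A B, A \subset B ->
  r ^+ #|B :\: A| * diluted r y q B <= diluted r y q A.
Proof.
move=> r0 y0 ry q1 A B AB; rewrite /diluted.
rewrite -(cardsID A B) (setIidPr AB) exprD.
have c0 : 0 <= r ^+ #|A| * (r ^+ 2) ^+ #|B :\: A|.
  by rewrite mulr_ge0 ?exprn_ge0// ltW.
have := ler_wpM2l c0 (rc_sum_leD y0 q1 AB).
rewrite [leRHS]mulrA -[_ * _ * (1 + y) ^+ _]mulrA -exprMn ry expr1n mulr1.
by congr (_ <= _); rewrite exprAC; ring.
Qed.
End EdgeWeights.

(** * Comparison of site measures *)

Section SiteWeights.
Variables (R : realFieldType) (I J : finType) (K : {set J} -> nat).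
Variables (E : {set I} -> {set J}) (m : nat).
Implicit Types (S T : {set I}) (r t y q : R).
Hypothesis K_anti : forall (A : {set J}) e, (K (e |: A) <= K A)%N.
Hypothesis K_drop : forall (A : {set J}) e, (K A <= (K (e |: A)).+1)%N.
Hypothesis K_step : forall (A B : {set J}) e,
  A \subset B -> (K (e |: A) + K B <= K A + K (e |: B))%N.
(** [E S] stands for the edges with both ends open. The union property is only an inclusion, because
    an edge may join [S :\: T] to [T :\: S]. The constant [m] is a degree bound, [2 * d] for the
    lattice. *)
Hypothesis E_setI : forall S T, E (S :&: T) = E S :&: E T.
Hypothesis E_setU : forall S T, E S :|: E T \subset E (S :|: T).
Hypothesis E_setD : forall S T, (#|E S :\: E T| <= m * #|S :\: T|)%N.

Definition site_weight t r y q S : R := t ^+ #|S| * diluted K r y q (E S).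

(** Replacing [f] by the nonnegative [f - f set0] subtracts the same quantity from both sides. The
    four functions theorem then applies, since [f S <= f (S :|: T)]. *)
Lemma holley (mu1 mu2 f : {set I} -> R) :
  (forall S, 0 <= mu1 S) -> (forall S, 0 <= mu2 S) ->
  (forall S T, mu1 S * mu2 T <= mu1 (S :&: T) * mu2 (S :|: T)) ->
  (forall S T, S \subset T -> f S <= f T) ->
  (\sum_S mu1 S * f S) * (\sum_S mu2 S) <= (\sum_S mu1 S) * (\sum_S mu2 S * f S).
Proof.
move=> mu10 mu20 mu12 f_mono.
have f0 S : 0 <= f S - f set0 by rewrite subr_ge0 f_mono ?sub0set.
have shift mu : \sum_S mu S * (f S - f set0) =
    \sum_S mu S * f S - (\sum_S mu S) * f set0.
  rewrite big_distrl -sumrB; apply: eq_bigr => S _; exact: mulrBr.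
suff : (\sum_S mu1 S * (f S - f set0)) * (\sum_S mu2 S) <=
    (\sum_S mu1 S) * (\sum_S mu2 S * (f S - f set0)) by rewrite !shift; lra.
have sumT (F : {set I} -> R) : \sum_S F S = \sum_(S : {set I} | S \subset setT) F S.
  by apply: eq_bigl => S; rewrite subsetT.
rewrite !(sumT (fun S => _ * _)) (sumT mu1) (sumT mu2).
apply: four_functions => [S|S|S|S|S T _ _]; rewrite ?mulr_ge0//.
rewrite mulrAC [leRHS]mulrA; apply: ler_pM; rewrite ?mulr_ge0//.
by rewrite lerD2r f_mono ?subsetUl.
Qed.

Lemma site_weight_gt0 t r y q S :
  0 < t -> 0 < r -> 0 <= y -> 1 <= q -> 0 < site_weight t r y q S.
Proof. by move=> t0 r0 y0 q1; rewrite mulr_gt0 ?exprn_gt0// diluted_gt0. Qed.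

Section Comparison.
Variables (t1 t2 r1 r2 y1 y2 q1 q2 : R).
Hypotheses (t1_gt0 : 0 < t1) (t2_gt0 : 0 < t2) (r1_gt0 : 0 < r1) (r2_gt0 : 0 < r2).
Hypotheses (y1_ge0 : 0 <= y1) (y2_ge0 : 0 <= y2).
Hypotheses (ry1 : r1 ^+ 2 * (1 + y1) = 1) (ry2 : r2 ^+ 2 * (1 + y2) = 1).
Hypotheses (q1_range : 1 <= q1 <= 2) (q2_range : 1 <= q2 <= 2).

Let q1_ge1 : 1 <= q1. Proof. by case/andP: q1_range. Qed.
Let q2_ge1 : 1 <= q2. Proof. by case/andP: q2_range. Qed.

Let diluted1_ge0 (A : {set J}) : 0 <= diluted K r1 y1 q1 A.
Proof. by rewrite ltW// diluted_gt0. Qed.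

Let diluted2_ge0 (A : {set J}) : 0 <= diluted K r2 y2 q2 A.
Proof. by rewrite ltW// diluted_gt0. Qed.

(** The condition is used with [A = E S], [B = E T] and [n = #|S :\: T|]. Passing from [E S :|: E T]
    to [E (S :|: T)] is allowed by [diluted_mono] for the second measure. *)
Let site_lattice_from :
  (forall (A B : {set J}) n, (#|A :\: B| <= m * n)%N ->
    t1 ^+ n * (diluted K r1 y1 q1 A * diluted K r2 y2 q2 B) <=
    t2 ^+ n * (diluted K r1 y1 q1 (A :&: B) * diluted K r2 y2 q2 (A :|: B))) ->
  forall S T, site_weight t1 r1 y1 q1 S * site_weight t2 r2 y2 q2 T <=
    site_weight t1 r1 y1 q1 (S :&: T) * site_weight t2 r2 y2 q2 (S :|: T).
Proof.
move=> H S T; rewrite /site_weight.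
rewrite cardsU_setD -{1}(cardsID T S) !exprD E_setI.
have c0 : 0 <= t1 ^+ #|S :&: T| * t2 ^+ #|T| by rewrite mulr_ge0 ?exprn_ge0 ?ltW.
have := ler_wpM2l c0 (H _ _ _ (E_setD S T)) => h.
apply: le_trans (_ : t1 ^+ #|S :&: T| * t2 ^+ #|T| * (t2 ^+ #|S :\: T| *
  (diluted K r1 y1 q1 (E S :&: E T) * diluted K r2 y2 q2 (E S :|: E T))) <= _).
  by move: h; congr (_ <= _); ring.
have := diluted_mono K_drop r2_gt0 y2_ge0 ry2 q2_range (E_setU S T).
have c1 : 0 <= t1 ^+ #|S :&: T| * t2 ^+ #|T| * t2 ^+ #|S :\: T| *
    diluted K r1 y1 q1 (E S :&: E T).
  apply: mulr_ge0 (diluted1_ge0 _).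
  by rewrite !mulr_ge0 ?exprn_ge0 ?(ltW t1_gt0) ?(ltW t2_gt0).
by move=> /(ler_wpM2l c1); congr (_ <= _); ring.
Qed.

Lemma site_lattice_same_q : t1 <= t2 -> y1 <= y2 -> q1 = q2 ->
  forall S T, site_weight t1 r1 y1 q1 S * site_weight t2 r2 y2 q2 T <=
    site_weight t1 r1 y1 q1 (S :&: T) * site_weight t2 r2 y2 q2 (S :|: T).
Proof.
move=> t12 y12 q12; apply: site_lattice_from => A B n _.
apply: ler_pM; [by rewrite exprn_ge0// ltW|exact: mulr_ge0| |].
  by rewrite lerXn2r ?nnegrE ?(ltW t1_gt0) ?(ltW t2_gt0).
move: q2_range; rewrite -q12 => ?; exact: diluted_lattice.
Qed.

(** The two measures are bounded separately: [diluted_mono] handles the second, and for the first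
    [diluted_leD] costs a factor [r1 ^- #|A :\: B|], at most [r1 ^- (m * n)], which the gap between
    [t1] and [t2] absorbs. *)
Lemma site_lattice_large_t : t1 <= t2 * r1 ^+ m ->
  forall S T, site_weight t1 r1 y1 q1 S * site_weight t2 r2 y2 q2 T <=
    site_weight t1 r1 y1 q1 (S :&: T) * site_weight t2 r2 y2 q2 (S :|: T).
Proof.
move=> t12; apply: site_lattice_from => A B n ABn.
have r1_le1 : r1 <= 1.
  rewrite -(@expr_le1 _ 2) ?(ltW r1_gt0)//.
  have := mulr_ge0 (sqr_ge0 r1) y1_ge0; move: ry1; lra.
rewrite [leLHS]mulrA [leRHS]mulrA; apply: ler_pM => //.
  by apply: mulr_ge0 (diluted1_ge0 _); rewrite exprn_ge0 ?ltW.
2: by apply: diluted_mono => //; exact: subsetUr.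
have := diluted_leD K_anti r1_gt0 y1_ge0 ry1 q1_ge1 (subsetIl A B).
rewrite setDIr setDv set0U => h.
apply: le_trans (_ : t2 ^+ n * (r1 ^+ #|A :\: B| * diluted K r1 y1 q1 A) <= _); last first.
  by rewrite ler_wpM2l ?exprn_ge0 ?(ltW t2_gt0).
rewrite mulrA ler_wpM2r ?diluted1_ge0//.
apply: le_trans (_ : (t2 * r1 ^+ m) ^+ n <= _).
  by rewrite lerXn2r ?nnegrE ?mulr_ge0 ?exprn_ge0 ?(ltW t1_gt0) ?(ltW t2_gt0) ?(ltW r1_gt0).
rewrite exprMn -exprM ler_wpM2l ?exprn_ge0 ?(ltW t2_gt0)//.
by rewrite ler_wiXn2l ?(ltW r1_gt0).
Qed.

Lemma site_lattice_rc : t1 * r1 ^+ m <= t2 * r2 ^+ m -> r2 <= r1 ->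
  (y1 <= y2 /\ q2 <= q1) \/ (q1 <= q2 /\ y1 / q1 <= y2 / q2) ->
  forall S T, site_weight t1 r1 y1 q1 S * site_weight t2 r2 y2 q2 T <=
    site_weight t1 r1 y1 q1 (S :&: T) * site_weight t2 r2 y2 q2 (S :|: T).
Proof.
move=> t12 r21 H; apply: site_lattice_from => A B n ABn.
have := diluted_lattice_rc K_anti K_drop K_step r1_gt0 r2_gt0 y1_ge0 y2_ge0
  q1_ge1 q2_ge1 H A B.
move: (#|A :\: B|) ABn => k kmn.
set x := (X in X * _ <= _ -> _); set z := (X in _ <= _ * X -> _).
have z0 : 0 <= z by exact: mulr_ge0.
have x0 : 0 <= x by exact: mulr_ge0.
(* At [k = m * n] this is the [n]-th power of the hypothesis; for smaller [k] both sides are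
   multiplied up to that exponent, using [r2 <= r1]. *)
have tr : t1 ^+ n * r1 ^+ k <= t2 ^+ n * r2 ^+ k.
  have r1k : 0 < r1 ^+ (m * n - k) by rewrite exprn_gt0.
  rewrite -(ler_pM2r r1k) -mulrA -exprD subnKC//.
  apply: le_trans (_ : t2 ^+ n * r2 ^+ k * r2 ^+ (m * n - k) <= _).
    rewrite -mulrA -exprD subnKC// !exprM -!exprMn.
    by rewrite lerXn2r ?nnegrE ?mulr_ge0 ?exprn_ge0 ?(ltW t1_gt0) ?(ltW t2_gt0)
      ?(ltW r1_gt0) ?(ltW r2_gt0).
  rewrite ler_wpM2l ?mulr_ge0 ?exprn_ge0 ?(ltW t2_gt0) ?(ltW r2_gt0)//.
  by rewrite lerXn2r ?nnegrE ?(ltW r1_gt0) ?(ltW r2_gt0).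
move=> xz; have r2k : 0 < r2 ^+ k by rewrite exprn_gt0.
rewrite -(ler_pM2r r2k).
apply: le_trans (_ : t1 ^+ n * r1 ^+ k * z <= _).
  by rewrite -[leLHS]mulrA -[leRHS]mulrA ler_wpM2l ?exprn_ge0 ?(ltW t1_gt0).
by apply: le_trans (ler_wpM2r z0 tr) _; rewrite mulrAC.
Qed.

End Comparison.
End SiteWeights.

(** * Clusters in a region *)

Section CountValues.
Variables (W : eqType) (T : eqType).
Implicit Types (s : seq W) (f : W -> T).

Lemma eq_size_undup (s t : seq T) : s =i t -> size (undup s) = size (undup t).
Proof.
move=> st; apply/perm_size/uniq_perm; rewrite ?undup_uniq// => x.
by rewrite !mem_undup st.
Qed.

Lemma size_undup_map_eq (f f' : W -> T) s :
  {in s &, forall x y, (f x == f y) = (f' x == f' y)} ->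
  size (undup (map f s)) = size (undup (map f' s)).
Proof.
elim: s => //= x s IH H.
have Es : (f x \in map f s) = (f' x \in map f' s).
  apply/mapP/mapP => -[y ys /eqP fxy]; exists y => //; apply/eqP;
    by rewrite ?H// -?H// !inE ?eqxx ?ys ?orbT.
have {}IH : size (undup (map f s)) = size (undup (map f' s)).
  by apply: IH => y z ys zs; apply: H; rewrite inE ?ys ?zs orbT.
by rewrite Es; case: ifP => /= _; rewrite IH.
Qed.

(** The hypothesis says that [f'] arises from [f] by identifying the values [f u] and [f v], so
    exactly one value is lost when they differ. *)
Lemma size_undup_map_merge (f f' : W -> T) s u v : u \in s -> v \in s ->
  {in s &, forall x y, (f' x == f' y) = [|| f x == f y,
     (f x == f u) && (f v == f y) | (f x == f v) && (f u == f y)]} ->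
  size (undup (map f s)) = (size (undup (map f' s)) + (f u != f v))%N.
Proof.
move=> us vs H; have [fuv|fuv] := eqVneq (f u) (f v).
  rewrite addn0; apply: size_undup_map_eq => x y xs ys.
  rewrite H// fuv orbb; case: (eqVneq (f x) (f v)) => [->|_] /=; rewrite ?orbb ?orbF//.
(* Dropping the entries of value [f v] removes one value of [f] and none of [f'], as [u] still
   represents the merged value; on the rest [f] and [f'] have the same coincidences. *)
pose s' := [seq x <- s | f x != f v].
have s'P x : x \in s' = (f x != f v) && (x \in s) by rewrite mem_filter.
have us' : u \in s' by rewrite s'P fuv us.
have -> : size (undup (map f s)) = (size (undup (map f s'))).+1.
  rewrite (@eq_size_undup _ (f v :: map f s')) /= ?ifN//.
    by apply/mapP => -[x]; rewrite s'P => /andP[/eqP xv _] /esym.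
  move=> z; rewrite inE; apply/mapP/orP => [[x xs ->]|[/eqP->|/mapP[x]]].
  - have [->|xv] := eqVneq (f x) (f v); [by left|right].
    by apply: map_f; rewrite s'P xv.
  - by exists v.
  - by rewrite s'P => /andP[_ xs] ->; exists x.
rewrite addn1; congr _.+1.
have -> : size (undup (map f' s)) = size (undup (map f' s')).
  apply: eq_size_undup => z; apply/mapP/mapP => -[x xs ->]; last first.
    by move: xs; rewrite s'P => /andP[_ xs]; exists x.
  have [xv|xv] := eqVneq (f x) (f v); last by exists x; rewrite ?s'P ?xv.
  by exists u => //; apply/eqP; rewrite H// xv !eqxx !orbT.
apply: size_undup_map_eq => x y; rewrite !s'P => /andP[xv xs] /andP[yv ys].
by rewrite H// (negbTE xv) [f v == _]eq_sym (negbTE yv) andbF !orbF.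
Qed.

End CountValues.

Section Region.
Variables (d : nat) (V : {fset vertex d}) (lambda : config d).
Implicit Types (S T : {set V}) (A B : {set region_edges V}).

Definition spins S : vertex d -> bool :=
  fun x => if insub x is Some v then v \in S else lambda.1 x.

Definition bonds A : edge d -> bool :=
  fun e => if insub e is Some f then f \in A else lambda.2 e.

Definition open_edges S : {set region_edges V} :=
  [set e | `[< edge_in (spins S) (val e) >]].

(* [connected] does not depend on the spins: all of Z^d is taken as vertex set. *)
Definition linked A : vertex d -> vertex d -> Prop :=
  connected (xpredT, bonds A).

Definition cluster A (x : vertex d) : set (vertex d) := [set y | linked A x y]%classic.

(** Counting distinct values of [cluster A] lets an added edge be treated by [size_undup_map_merge].
    Closed vertices of [region_plus V] are counted too. *)
Definition num_clusters A : nat :=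
  size (undup [seq cluster A x | x <- region_plus V]).

Lemma num_clustersE A : num_clusters A = #|` [fset cluster A x | x in region_plus V]%fset|.
Proof.
rewrite /num_clusters -card_fseq; congr #|` _|; apply/fsetP => C; rewrite !inE.
by apply/mapP/imfsetP => -[x /= xW ->]; exists x.
Qed.

Lemma spins_val S (v : V) : spins S (val v) = (v \in S).
Proof. by rewrite /spins valK. Qed.

Lemma spins_out S x : x \notin V -> spins S x = lambda.1 x.
Proof. by move=> xV; rewrite /spins insubN. Qed.

Lemma bonds_val A (e : region_edges V) : bonds A (val e) = (e \in A).
Proof. by rewrite /bonds valK. Qed.

Lemma bonds_out A e : e \notin region_edges V -> bonds A e = lambda.2 e.
Proof. by move=> eE; rewrite /bonds insubN. Qed.

Lemma bonds_setU1 A f e : bonds (f |: A) e = (e == val f) || bonds A e.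
Proof.
have [eE|eE] := boolP (e \in region_edges V); last first.
  rewrite !bonds_out//; case: eqP => // ef.
  by move: eE; rewrite ef; have := valP f => ->.
have -> : e = val [` eE]%fset by [].
by rewrite !bonds_val !inE (inj_eq val_inj).
Qed.

Lemma linked_refl A x : linked A x x.
Proof. by exists [::]. Qed.

Lemma linked_trans A y x z : linked A x y -> linked A y z -> linked A x z.
Proof.
case=> s ps <- [t pt <-]; exists (s ++ t); last by rewrite last_cat.
by rewrite cat_path ps.
Qed.

Lemma linked_sym A x y : linked A x y -> linked A y x.
Proof.
case=> s p <-; exists (rev (belast x s)).
  rewrite rev_path; apply: sub_path p => u v /asboolP[e ee oe].
  by apply/asboolP; exists e => //; rewrite fsetUC.
by case: s {p} => //= y0 s; rewrite rev_cons last_rcons.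
Qed.

Lemma linked_step A e x y :
  ends e = [fset x; y]%fset -> bonds A e -> linked A x y.
Proof. by move=> exy eA; exists [:: y] => //=; rewrite andbT; apply/asboolP; exists e. Qed.

Lemma linked_mono A B x y : A \subset B -> linked A x y -> linked B x y.
Proof.
move=> AB [s p <-]; exists s => //; apply: sub_path p => u v /asboolP[e ee eA].
apply/asboolP; exists e => //; move: eA; rewrite /= /bonds.
by case: insubP => //= f _ _; exact/subsetP.
Qed.

(** Induction along the path; a path that crosses the new edge more than once can be shortened to at
    most one crossing. *)
Lemma linked_setU1 A f u v x y : ends (val f) = [fset u; v]%fset ->
  linked (f |: A) x y <->
  [\/ linked A x y, linked A x u /\ linked A v y | linked A x v /\ linked A u y].
Proof.
move=> fuv; split; last first.
  have fA : bonds (f |: A) (val f) by rewrite bonds_val setU11.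
  have mono a b : linked A a b -> linked (f |: A) a b.
    by apply: linked_mono; exact: subsetUr.
  have uv := linked_step fuv fA.
  by case=> [/mono//|[/mono xu /mono vy]|[/mono xv /mono uy]];
    [apply: linked_trans xu (linked_trans uv vy)|
     apply: linked_trans xv (linked_trans (linked_sym uv) uy)].
case=> s p <- {y}; elim: s x p => [|z s IH] x /=.
  by move=> _; constructor 1; exact: linked_refl.
case/andP=> /asboolP[e exz]; rewrite /= bonds_setU1 => eA /IH{}IH.
have [ef|xz] : (ends (val f) = [fset x; z]%fset) \/ linked A x z.
    case/orP: eA => [/eqP <-|eA]; [by left|right]; exact: linked_step eA.
(* Only the membership of [x] and [z] in the pair of ends is used, hence the degenerate case
   [x = z], which the induction hypothesis settles. *)
- have : (x = u /\ z = v) \/ (x = v /\ z = u) \/ (x = z).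
    have E a : (a \in [fset u; v])%fset = (a \in [fset x; z])%fset by rewrite -fuv ef.
    have := E z; have := E x; rewrite !inE !eqxx !orbT.
    by do 2!case/orP=> /eqP ->; auto.
  move=> H; move: IH; case: H => [[-> ->]|[[-> ->]|->//]].
  + case=> [h|[h1 h2]|[h1 h2]].
    * by constructor 2; split=> //; exact: linked_refl.
    * by constructor 2; split=> //; exact: linked_refl.
    * by constructor 1.
  + case=> [h|[h1 h2]|[h1 h2]].
    * by constructor 3; split=> //; exact: linked_refl.
    * by constructor 1.
    * by constructor 3; split=> //; exact: linked_refl.
- case: IH => [h|[h1 h2]|[h1 h2]].
  + by constructor 1; exact: linked_trans h.
  + by constructor 2; split=> //; exact: linked_trans h1.
  + by constructor 3; split=> //; exact: linked_trans h1.
Qed.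

Lemma eq_cluster A x y : (cluster A x == cluster A y) = `[< linked A x y >].
Proof.
apply/eqP/asboolP => [xy|xy].
  have : cluster A y y by exact: linked_refl.
  by rewrite -xy.
apply/seteqP; split=> z /=; last exact: linked_trans.
exact/linked_trans/linked_sym.
Qed.

Lemma region_edge_ends (e : region_edges V) : exists u v,
  [/\ u \in region_plus V, v \in region_plus V & ends (val e) = [fset u; v]%fset].
Proof.
have /asboolP[u [v [_ euv]]] := svalP (val e).
have sub x : x \in ends (val e) -> x \in region_plus V.
  by move=> xe; apply/bigfcupP; exists (val e) => //; rewrite andbT; exact: valP.
by exists u, v; split=> //; apply: sub; rewrite /ends euv !inE eqxx ?orbT.
Qed.

Lemma num_clusters_setU1 A e u v : u \in region_plus V -> v \in region_plus V ->
  ends (val e) = [fset u; v]%fset ->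
  num_clusters A = (num_clusters (e |: A) + ~~ `[< linked A u v >])%N.
Proof.
move=> uW vW euv; rewrite -eq_cluster; apply: size_undup_map_merge => // x y _ _.
rewrite !eq_cluster; apply/asboolP/or3P => [/(linked_setU1 A x y euv)|H].
  case=> [h|[h1 h2]|[h1 h2]]; [constructor 1|constructor 2|constructor 3].
  - exact/asboolP.
  - by apply/andP; split; apply/asboolP.
  - by apply/andP; split; apply/asboolP.
apply/(linked_setU1 A x y euv).
case: H => [/asboolP h|/andP[/asboolP h1 /asboolP h2]|/andP[/asboolP h1 /asboolP h2]];
  by [constructor 1|constructor 2|constructor 3].
Qed.

Lemma num_clusters_anti A e : (num_clusters (e |: A) <= num_clusters A)%N.
Proof.
have [u [v [uW vW euv]]] := region_edge_ends e.
by rewrite (num_clusters_setU1 A uW vW euv) leq_addr.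
Qed.

Lemma num_clusters_drop A e : (num_clusters A <= (num_clusters (e |: A)).+1)%N.
Proof.
have [u [v [uW vW euv]]] := region_edge_ends e.
by rewrite (num_clusters_setU1 A uW vW euv) -addn1 leq_add2l leq_b1.
Qed.

(** An edge that merges two clusters for [B] also merges two for the smaller [A], because [linked]
    is monotone in the bonds. *)
Lemma num_clusters_step A B e : A \subset B ->
  (num_clusters (e |: A) + num_clusters B <= num_clusters A + num_clusters (e |: B))%N.
Proof.
move=> AB; have [u [v [uW vW euv]]] := region_edge_ends e.
rewrite (num_clusters_setU1 A uW vW euv) (num_clusters_setU1 B uW vW euv).
rewrite addnA [leqRHS]addnAC leq_add2l.
have [//|uv] := asboolP (linked B u v).
by case: asboolP => // /(linked_mono AB).
Qed.

Lemma open_edges_setI S T : open_edges (S :&: T) = open_edges S :&: open_edges T.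
Proof.
have spinsI x : spins (S :&: T) x = spins S x && spins T x.
  by rewrite /spins; case: insubP => [v _ _|_]; rewrite ?inE ?andbb.
apply/setP => e; rewrite !inE; apply/asboolP/andP => [H|[/asboolP H1 /asboolP H2] x xe].
  by split; apply/asboolP => x /H; rewrite spinsI => /andP[].
by rewrite spinsI H1 ?H2.
Qed.

Lemma open_edges_mono S T : S \subset T -> open_edges S \subset open_edges T.
Proof. by move=> /setIidPl ST; apply/setIidPl; rewrite -open_edges_setI ST. Qed.

Lemma open_edges_setU S T :
  open_edges S :|: open_edges T \subset open_edges (S :|: T).
Proof. by rewrite subUset !open_edges_mono ?subsetUl ?subsetUr. Qed.

End Region.

(** * Covering bounds and the degree of the lattice *)

Lemma leq_card_cover (T U : finType) (A : {set T}) (P : {set U}) (F : U -> {set T}) k :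
  (forall x, x \in A -> exists2 i, i \in P & x \in F i) ->
  (forall i, i \in P -> #|F i| <= k)%N -> (#|A| <= k * #|P|)%N.
Proof.
move=> AF Fk; rewrite mulnC -sum_nat_const.
apply: (@leq_trans (\sum_(i in P) #|F i|)%N); last exact: leq_sum.
rewrite -sum1_card.
apply: leq_trans (_ : \sum_(x in A) \sum_(i in P) (x \in F i) <= _)%N.
  apply: leq_sum => x /AF[i iP xi]; rewrite (bigD1 i)//= xi; exact: leq_addr.
rewrite exchange_big; apply: leq_sum => i _.
rewrite -sum1_card big_mkcond [leqRHS]big_mkcond; apply: leq_sum => x _ /=.
by case: (x \in A); case: (x \in F i).
Qed.

Section Degree.
Variable d : nat.
Implicit Types x y : vertex d.

(** Neighbours are indexed by a type with [2 * d] elements; the sign [true] is the step [-1]. *)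
Definition shift x (ib : 'I_d * bool) : vertex d :=
  [ffun j => x j + (if j == ib.1 then (-1) ^+ ib.2 else 0)].

Lemma adjacent_shift x ib : adjacent x (shift x ib).
Proof.
case: ib => i b; rewrite /adjacent (bigD1 i)//= big1 => [|j ji].
  by rewrite ffunE eqxx opprD addNKr normrN normrX normrN1 expr1n addr0.
by rewrite ffunE (negbTE ji) addr0 subrr normr0.
Qed.

(** A sum of absolute values of integers equal to 1 has one term equal to 1 and all others zero. *)
Lemma adjacentP x y : adjacent x y -> exists ib, y = shift x ib.
Proof.
move=> xy.
have [i xyi] : exists i, x i != y i.
  apply/existsP; rewrite -[X in is_true X]negbK negb_exists; apply/negP => /forallP H.
  have := xy; rewrite /adjacent big1// => i _.
  by have /negPn/eqP -> := H i; rewrite subrr normr0.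
have xyi1 : 1 <= `|x i - y i| by rewrite -gtz0_ge1 normr_gt0 subr_eq0.
have := xy; rewrite /adjacent (bigD1 i)//= => sum1.
have rest0 : \sum_(j < d | j != i) `|x j - y j| = 0.
  by apply/eqP; rewrite eq_le sumr_ge0// andbT; lra.
have xyj j : j != i -> y j = x j.
  move=> ji; move/eqP: rest0; rewrite psumr_eq0// => /allP/(_ j (mem_index_enum _)).
  by rewrite ji normr_eq0 subr_eq0 => /eqP.
have {}sum1 : `|x i - y i| = 1 by rewrite -sum1 rest0 addr0.
exists (i, (0 <= x i - y i)); apply/ffunP => j; rewrite ffunE /=.
case: eqVneq => [->|/xyj->]; last by rewrite addr0.
move: sum1; case: ger0P => /= _; rewrite ?expr1 ?expr0; lra.
Qed.

End Degree.

(** * The marginal on spins *)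

Section SpinMarginal.
Variables (d : nat) (V : {fset vertex d}) (lambda : config d).
Hypothesis lambdaP : Theta lambda.
Implicit Types (S T : {set V}) (A B : {set region_edges V}).

Local Notation spins := (@spins d V lambda).
Local Notation bonds := (@bonds d V lambda).
Local Notation open_edges := (open_edges lambda).
Local Notation cluster := (cluster lambda).
Local Notation linked := (linked lambda).
Local Notation num_clusters := (num_clusters lambda).

Lemma card_incident_edges (x : vertex d) :
  (#|[set e : region_edges V | x \in ends (val e)]| <= 2 * d)%N.
Proof.
have -> : (2 * d)%N = #|[set: 'I_d * bool]|.
  by rewrite cardsT card_prod card_ord card_bool mulnC.
(* Each of the [2 * d] neighbours of [x] determines at most one edge, so the cover uses sets of size
   at most 1. *)
rewrite -[leqRHS]mul1n.
apply: (@leq_card_cover _ _ _ _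
  (fun ib => [set e | ends (val e) == [fset x; shift x ib]%fset])) => [e|ib _].
  rewrite inE => xe; have /asboolP[u [v [uv euv]]] := svalP (val e).
  move: xe; rewrite /ends euv !inE => /orP[]/eqP ?; subst x.
    by have [ib vE] := adjacentP uv; exists ib; rewrite ?inE// /ends euv vE.
  have [ib uE] := adjacentP (adjacentC uv); exists ib; rewrite ?inE//.
  by rewrite /ends euv uE fsetUC.
apply/card_le1P => e; rewrite inE => /eqP ee f; rewrite !inE.
by apply/eqP/eqP => [fe|->//]; apply/val_inj/val_inj; exact: etrans fe (esym ee).
Qed.

(** An edge open for [S] but not for [T] has an end where the spins differ. Outside [V] both agree
    with [lambda], so this end lies in [S :\: T], and each vertex has at most [2 * d] edges. *)
Lemma card_open_edges_setD S T :
  (#|open_edges S :\: open_edges T| <= 2 * d * #|S :\: T|)%N.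
Proof.
apply: (@leq_card_cover _ _ _ _
  (fun v => [set e : region_edges V | val v \in ends (val e)])) => [e|v _]; last first.
  exact: card_incident_edges.
rewrite !inE => /andP[/asboolPn eT /asboolP eS].
have [x [xe xT]] : exists x, x \in ends (val e) /\ ~~ spins T x.
  apply: contrapT => H; apply: eT => x xe; apply/negPn/negP => xT; apply: H; by exists x.
have xV : x \in V.
  by apply/negPn/negP => xV; move: xT (eS x xe); rewrite !spins_out// => /negP.
exists [` xV]%fset; rewrite ?inE//.
by have := eS x xe; move: xT; rewrite -(spins_val lambda S) -(spins_val lambda T) => -> ->.
Qed.

Lemma conf_bc S A : A \subset open_edges S ->
  Theta_bc V lambda (spins S, bonds A).
Proof.
move=> AS; split=> [e|x xV|e eE] /=.
- have [eE|eE] := boolP (e \in region_edges V).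
    have -> : e = val [` eE]%fset by [].
    by rewrite bonds_val => /(subsetP AS); rewrite inE => /asboolP.
  (* An edge outside the region has no end in [V], so it inherits compatibility from [lambda]. *)
  rewrite bonds_out// => /lambdaP el x xe; rewrite spins_out; first exact: el.
  by apply: contra eE => xV; apply/mem_region_edges; exists x.
- exact: spins_out.
- exact: bonds_out.
Qed.

Lemma bc_conf theta : Theta_bc V lambda theta -> exists S A,
  A \subset open_edges S /\ theta = (spins S, bonds A).
Proof.
case: theta => psi om [/= th hV hE].
pose S := [set v : V | psi (val v)]; pose A := [set e : region_edges V | om (val e)].
have psiE : psi = spins S.
  apply/funext => x; have [xV|xV] := boolP (x \in V); last by rewrite spins_out ?hV.
  by have -> : x = val [` xV]%fset by []; rewrite spins_val inE.
have omE : om = bonds A.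
  apply/funext => e; have [eE|eE] := boolP (e \in region_edges V).
    by have -> : e = val [` eE]%fset by []; rewrite bonds_val inE.
  by rewrite bonds_out ?hE.
exists S, A; split; last by rewrite -psiE -omE.
by apply/subsetP => e; rewrite !inE -psiE => /th ?; apply/asboolP.
Qed.

Lemma spins_inj : injective spins.
Proof. by move=> S T ST; apply/setP => v; rewrite -!(spins_val lambda) ST. Qed.

Lemma bonds_inj : injective bonds.
Proof. by move=> A B AB; apply/setP => e; rewrite -!(bonds_val lambda) AB. Qed.

Lemma sum_open_region_edges S (F : edge d -> nat) :
  (\sum_(e <- open_region_edges V (spins S)) F e = \sum_(e in open_edges S) F (val e))%N.
Proof.
rewrite /open_region_edges big_fset /= big_seq_fsetE; apply: eq_bigl => e.
by rewrite inE.
Qed.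

Lemma card_open_region_edges S :
  #|` open_region_edges V (spins S)| = #|open_edges S|.
Proof. by rewrite card_fset_sum1 sum_open_region_edges sum1_card. Qed.

Lemma prod_open_region_edges (R : realType) S A (y : R) : A \subset open_edges S ->
  \prod_(e <- open_region_edges V (spins S)) y ^+ bonds A e = y ^+ #|A|.
Proof.
move=> AS; rewrite prodrXr; congr (_ ^+ _).
rewrite (sum_open_region_edges S (fun e => bonds A e : nat)).
under eq_bigr do rewrite bonds_val.
rewrite -big_mkcondr (eq_bigl (mem A)) ?sum1_card// => e /=.
by case: (boolP (e \in A)) => [/(subsetP AS)->|]; rewrite ?andbF.
Qed.

Lemma prod_region (R : realType) S (t : R) :
  \prod_(x <- V) t ^+ spins S x = t ^+ #|S|.
Proof.
rewrite prodrXr; congr (_ ^+ _); rewrite big_seq_fsetE.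
under eq_bigr do rewrite spins_val.
by rewrite -big_mkcond sum1_card.
Qed.

Lemma region_plusP x : reflect (exists2 e, e \in region_edges V & x \in ends e)
  (x \in region_plus V).
Proof.
apply: (iffP (bigfcupP _ _ _ _)) => [[e]|[e eE xe]]; last by exists e; rewrite ?eE.
by rewrite andbT; exists e.
Qed.

Lemma sub_region_plus : (0 < d)%N -> {subset V <= region_plus V}.
Proof.
move=> d0 x xV; pose y := shift x (Ordinal d0, true).
have xyE : is_edge [fset x; y]%fset.
  by apply/asboolP; exists x, y; split=> //; exact: adjacent_shift.
pose e : edge d := exist (fun e : {fset vertex d} => is_edge e) _ xyE.
have xe : x \in ends e by rewrite !inE eqxx.
by apply/region_plusP; exists e => //; apply/mem_region_edges; exists x.
Qed.

(** Open edges have open ends, so a closed vertex is linked to itself only. *)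
Lemma linked_spins S A x y : A \subset open_edges S -> linked A x y ->
  x = y \/ (spins S x /\ spins S y).
Proof.
move=> /conf_bc[/= th _ _].
have step u v : open_step (xpredT, bonds A) u v -> spins S u /\ spins S v.
  by move=> /asboolP[e ee /th h]; split; apply: h; rewrite ee !inE eqxx ?orbT.
case=> s p <-{y}; elim: s x p => [|z s IH] x /=; first by left.
case/andP=> /step[xo zo] /IH[<-|[_ lo]]; by right.
Qed.

Lemma components_meetingE S A : A \subset open_edges S ->
  components_meeting V (spins S, bonds A) =
  [set cluster A x | x in [set` [fset x in region_plus V | spins S x]]]%fset%classic.
Proof.
move=> AS; apply/seteqP; split=> C.
  case=> -[x /= xo ->] [y [/= xy yW]]; exists y => /=.
    by rewrite !inE yW /=; case: (linked_spins AS xy) => [<-|[]].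
  by apply/eqP; rewrite eq_cluster; apply/asboolP/linked_sym.
case=> x /=; rewrite !inE => /andP[xW xo] <-; split; first by exists x.
by exists x; split=> //=; exact: linked_refl.
Qed.

Definition closed_outside : nat :=
  (\sum_(x <- region_plus V | x \notin V) ~~ lambda.1 x)%N.

(** The closed vertices of [region_plus V] are those of [V] outside [S] and those fixed by
    [lambda]. *)
Lemma card_closed S : (0 < d)%N ->
  (#|` [fset x in region_plus V | ~~ spins S x]%fset| + #|S| =
   #|` V| + closed_outside)%N.
Proof.
move=> d0; rewrite card_fset_sum1 big_fset /= big_mkcond /=.
rewrite (bigID (fun x => x \in V)) /= big_fset_condE /=.
have -> : [fset x in region_plus V | x \in V]%fset = V.
  apply/fsetP => x; rewrite !inE andbC.
  by case: (boolP (x \in V)) => //= /(sub_region_plus d0).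
rewrite addnAC; congr (_ + _)%N; last first.
  apply: eq_bigr => x xV; rewrite spins_out//; by case: (lambda.1 x).
rewrite big_seq_fsetE /=.
under eq_bigr do rewrite spins_val if_neg.
rewrite -sum1_card [X in (_ + X)%N]big_mkcond -big_split /=.
rewrite (eq_bigr (fun=> 1%N)) => [|v _]; last by case: (v \in S).
by rewrite sum1_card cardfE.
Qed.

(** [num_clusters] counts the components that meet [region_plus V] and one singleton for each closed
    vertex there; [card_closed] counts the latter. The additive form avoids truncated
    subtraction. *)
Lemma num_componentsE S A : (0 < d)%N -> A \subset open_edges S ->
  (num_components V (spins S, bonds A) + (#|` V| + closed_outside) =
   num_clusters A + #|S|)%N.
Proof.
move=> d0 AS; rewrite -(card_closed S d0) addnA; congr (_ + _)%N.
rewrite /num_components components_meetingE// fset_set_image// set_fsetK.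
set Wo := [fset x in _ | spins S x]%fset; set Wc := [fset x in _ | ~~ spins S x]%fset.
rewrite num_clustersE.
have WE : region_plus V = (Wo `|` Wc)%fset.
  apply/fsetP => x; rewrite !inE -andb_orr.
  by case: (spins S x); rewrite andbT.
rewrite WE imfsetU cardfsU.
(* Open and closed vertices never share a cluster, and [cluster A] is injective on closed ones. *)
have -> : (cluster A @` Wo `&` cluster A @` Wc)%fset = fset0.
  apply/fsetP => C; rewrite !inE; apply/negP => /andP[/imfsetP[x /=] + ->] /imfsetP[y /=].
  rewrite !inE => /andP[_ xo] /andP[_ yc] /eqP; rewrite eq_cluster => /asboolP.
  move=> /(linked_spins AS)[xy|[_ yo]]; last by rewrite yo in yc.
  by rewrite -xy xo in yc.
rewrite cardfs0 subn0; congr (_ + _)%N; apply/esym/card_in_imfset => x y /=.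
rewrite !inE => /andP[_ xc] /andP[_ yc] /eqP; rewrite eq_cluster => /asboolP.
by move=> /(linked_spins AS)[//|[xo _]]; rewrite xo in xc.
Qed.

Section Weights.
Variable R : realType.
Implicit Types a p q : R.

Definition normalization q : R := q ^+ (#|` V| + closed_outside).

(** The term [#|S|] in [num_componentsE] moves a factor [q] per open vertex into the vertex
    activity, which becomes [q * (a / (1 - a))]. *)
Lemma weightE a p q S A : (0 < d)%N -> 0 < q -> A \subset open_edges S ->
  weight V a p q (spins S, bonds A) =
  (q * (a / (1 - a))) ^+ #|S| * (Num.sqrt (1 - p) ^+ #|open_edges S|
  * rc_weight num_clusters (p / (1 - p)) q A) / normalization q.
Proof.
move=> d0 q0 AS; rewrite /weight card_open_region_edges prod_region.
rewrite prod_open_region_edges// /rc_weight [(q * _) ^+ _]exprMn.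
have -> : q ^+ num_components V (spins S, bonds A) =
    q ^+ num_clusters A * q ^+ #|S| / normalization q.
  rewrite -exprD -(num_componentsE d0 AS) exprD mulfK//.
  by rewrite expf_eq0 (gt_eqF q0) andbF.
move: (Num.sqrt _ ^+ _) (q ^+ num_clusters A) (q ^+ #|S|) (normalization q)^-1.
by move: ((a / _) ^+ _) ((p / _) ^+ _) => *; ring.
Qed.

Lemma sum_bc (F : config d -> R) :
  \sum_(theta \in Theta_bc V lambda) F theta =
  \sum_S \sum_(A : {set region_edges V} | A \subset open_edges S) F (spins S, bonds A).
Proof.
pose P := [set SA : {set V} * {set region_edges V} | SA.2 \subset open_edges SA.1]%classic.
pose conf (SA : {set V} * {set region_edges V}) : config d := (spins SA.1, bonds SA.2).
have -> : Theta_bc V lambda = (conf @` P)%classic.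
  apply/seteqP; split=> theta; last by case=> -[S A] AS <-; exact: conf_bc.
  by case/bc_conf => S [A [AS ->]]; exists (S, A).
rewrite fsbig_image; last first.
  by move=> [S A] [T B] _ _ [/spins_inj -> /bonds_inj ->].
rewrite pair_big_dep /= -[RHS]big_filter [RHS]fsbig_seq ?filter_uniq ?index_enum_uniq//.
apply: eq_fsbigl; apply/seteqP; split=> -[S A]; rewrite /= mem_filter mem_index_enum andbT //.
Qed.

Definition spin_weight a p q : {set V} -> R :=
  site_weight num_clusters open_edges (q * (a / (1 - a))) (Num.sqrt (1 - p))
    (p / (1 - p)) q.

Lemma sum_weight a p q S : (0 < d)%N -> 0 < q ->
  \sum_(A : {set region_edges V} | A \subset open_edges S)
    weight V a p q (spins S, bonds A) = spin_weight a p q S / normalization q.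
Proof.
move=> d0 q0; rewrite /spin_weight /site_weight /diluted /rc_sum.
rewrite !big_distrr /= big_distrl /=; apply: eq_bigr => A AS.
exact: weightE.
Qed.

Lemma drc_marginalE a p q S : (0 < d)%N -> 0 < q ->
  drc_marginal V lambda a p q [ffun v => v \in S] =
  spin_weight a p q S / \sum_T spin_weight a p q T.
Proof.
move=> d0 q0; rewrite /drc_marginal.
set M := (X in \sum_(theta \in X) _).
pose Z := partition_function V lambda a p q.
(* [M] fixes only the spins in [V]; since [drc] vanishes off [Theta_bc V lambda], the sum is moved
   to that finite set. *)
have -> : \sum_(theta \in M) drc V lambda a p q theta =
    \sum_(theta \in Theta_bc V lambda)
      if theta \in M then weight V a p q theta / Z else 0.
  by rewrite -fsbig_mkcondl fsbig_mkcondr.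
rewrite sum_bc (bigD1 S)//= [X in _ + X]big1 ?addr0 => [|T TS]; last first.
  apply: big1 => A AT; rewrite ifN//; apply: contra TS.
  move/set_mem => MT; apply/eqP/setP => v.
  by have := MT v; rewrite /= spins_val ffunE.
have -> : Z = (\sum_T spin_weight a p q T) / normalization q.
  rewrite /Z /partition_function sum_bc big_distrl /=.
  by apply: eq_bigr => T _; exact: sum_weight.
rewrite (eq_bigr (fun A => weight V a p q (spins S, bonds A) /
  ((\sum_T spin_weight a p q T) / normalization q))) => [|A AS].
  rewrite -big_distrl /= sum_weight// invf_div mulrA divfK//.
  by rewrite expf_eq0 (gt_eqF q0) andbF.
by rewrite ifT//; apply/mem_set => v /=; rewrite spins_val ffunE.
Qed.

End Weights.
End SpinMarginal.

(** * Parameters and the stochastic comparison *)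

Lemma odds_mono (R : realFieldType) (x y : R) : x <= y -> y < 1 ->
  x / (1 - x) <= y / (1 - y).
Proof.
move=> xy y1; have [x1' y1'] : 0 < 1 - x /\ 0 < 1 - y by split; lra.
by rewrite ler_pdivrMr// mulrAC ler_pdivlMr//; lra.
Qed.

Lemma sqrt_odds (R : realType) (p : R) : p < 1 ->
  Num.sqrt (1 - p) ^+ 2 * (1 + p / (1 - p)) = 1.
Proof.
move=> p1; rewrite sqr_sqrtr ?subr_ge0 ?ltW//.
by field; lra.
Qed.

Lemma powR_half_delta (R : realType) (d : nat) (p : R) : p < 1 ->
  (1 - p) `^ ((2 * d)%:R / 2) = Num.sqrt (1 - p) ^+ (2 * d).
Proof.
move=> p1; rewrite natrM mulrAC divff ?pnatr_eq0// mul1r powR_mulrn ?subr_ge0 ?ltW//.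
by rewrite exprM sqr_sqrtr ?subr_ge0 ?ltW.
Qed.

Section Marginals.
Variables (R : realType) (d : nat) (V : {fset vertex d}) (lambda : config d).
Hypotheses (lambdaP : Theta lambda) (d_gt0 : (0 < d)%N).

Lemma spin_weight_gt0 (a p q : R) (S : {set V}) : 0 < a < 1 -> 0 <= p < 1 -> 1 <= q ->
  0 < spin_weight lambda a p q S :> R.
Proof.
move=> /andP[a0 a1] /andP[p0 p1] q1; have q0 := lt_le_trans ltr01 q1.
by rewrite site_weight_gt0 ?mulr_gt0 ?divr_ge0 ?sqrtr_gt0 ?invr_gt0 ?subr_gt0 ?subr_ge0// ltW.
Qed.

(** Identifying a spin configuration with its set of open vertices turns both expectations into
    quotients of sums over sets; after clearing denominators the claim is [holley]. *)
Lemma stoch_le_marginal (a1 a2 p1 p2 q1 q2 : R) :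
  0 < a1 < 1 -> 0 < a2 < 1 -> 0 <= p1 < 1 -> 0 <= p2 < 1 -> 1 <= q1 -> 1 <= q2 ->
  (forall S T : {set V},
     spin_weight lambda a1 p1 q1 S * spin_weight lambda a2 p2 q2 T <=
     spin_weight lambda a1 p1 q1 (S :&: T) * spin_weight lambda a2 p2 q2 (S :|: T)) ->
  stoch_le (drc_marginal V lambda a1 p1 q1) (drc_marginal V lambda a2 p2 q2).
Proof.
move=> a1r a2r p1r p2r q1r q2r lattice f f_incr.
have w1 (S : {set V}) := @spin_weight_gt0 a1 p1 q1 S a1r p1r q1r.
have w2 (S : {set V}) := @spin_weight_gt0 a2 p2 q2 S a2r p2r q2r.
pose ff (S : {set V}) : {ffun V -> bool} := [ffun v => v \in S].
have expE a p q : 1 <= q -> expectation (drc_marginal V lambda a p q) f =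
    (\sum_S spin_weight lambda a p q S * f (ff S)) /
    \sum_(S : {set V}) spin_weight lambda a p q S.
  move=> q1'; rewrite /expectation.
  rewrite (reindex_onto ff (fun s => [set v | s v])) /=; last first.
    by move=> s _; apply/ffunP => v; rewrite ffunE inE.
  rewrite big_distrl /=; apply: eq_big => [S|S _].
    by apply/eqP/setP => v; rewrite inE ffunE.
  rewrite drc_marginalE// ?(lt_le_trans ltr01)//. exact: mulrAC.
rewrite !expE//.
have tot (w : {set V} -> R) : (forall S, 0 < w S) -> 0 < \sum_S w S.
  move=> w0; rewrite (bigD1 set0)//= ltr_wpDr//.
  by apply: sumr_ge0 => S _; exact: ltW.
rewrite ler_pdivrMr ?tot// mulrAC ler_pdivlMr ?tot//.
rewrite [leRHS]mulrC; apply: holley => // [S|S|S T ST]; try exact: ltW.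
by apply: f_incr => v; rewrite !ffunE; exact/subsetP.
Qed.

End Marginals.

Theorem theorem5p9 (R : realType) (d : nat) (d_ge2 : (2 <= d)%N)
  (V : {fset vertex d}) (lambda : config d) (lambdaP : Theta lambda)
  (a1 a2 p1 p2 q1 q2 : R)
  (a1_range : 0 < a1 < 1) (a2_range : 0 < a2 < 1)
  (p1_range : 0 <= p1 < 1) (p2_range : 0 <= p2 < 1)
  (q1_range : 1 <= q1 <= 2) (q2_range : 1 <= q2 <= 2) :
  let delta : R := (2 * d)%:R in
  let Phi1 := drc_marginal V lambda a1 p1 q1 in
  let Phi2 := drc_marginal V lambda a2 p2 q2 in
  [/\ (* (i) *)
      [/\ a1 <= a2, p1 <= p2 & q1 = q2] -> stoch_le Phi1 Phi2,
      (* (ii) *)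
      q2 * (a2 / (1 - a2)) >=
        q1 * (a1 / (1 - a1)) * (1 - p1) `^ (- (delta / 2)) ->
      stoch_le Phi1 Phi2,
      (* (iii) *)
      [/\ p1 <= p2, q1 >= q2 &
          q2 * (a2 / (1 - a2)) * (1 - p2) `^ (delta / 2) >=
            q1 * (a1 / (1 - a1)) * (1 - p1) `^ (delta / 2)] ->
      stoch_le Phi1 Phi2 &
      (* (iv) *)
      [/\ q1 <= q2,
          q2 * (a2 / (1 - a2)) * (1 - p2) `^ (delta / 2) >=
            q1 * (a1 / (1 - a1)) * (1 - p1) `^ (delta / 2) &
          p2 / (q2 * (1 - p2)) >= p1 / (q1 * (1 - p1))] ->
      stoch_le Phi1 Phi2].
Proof.
move=> delta Phi1 Phi2.
have d_gt0 : (0 < d)%N by apply: leq_trans d_ge2.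
have [[a10 a11] [a20 a21]] := (andP a1_range, andP a2_range).
have [[p10 p11] [p20 p21]] := (andP p1_range, andP p2_range).
have [[q11 q12] [q21 q22]] := (andP q1_range, andP q2_range).
have stoch := stoch_le_marginal lambdaP d_gt0 a1_range a2_range p1_range p2_range q11 q21.
have q10 := lt_le_trans ltr01 q11; have q20 := lt_le_trans ltr01 q21.
have t1 : 0 < q1 * (a1 / (1 - a1)) by rewrite mulr_gt0// divr_gt0// subr_gt0.
have t2 : 0 < q2 * (a2 / (1 - a2)) by rewrite mulr_gt0// divr_gt0// subr_gt0.
have r1 : 0 < Num.sqrt (1 - p1) by rewrite sqrtr_gt0 subr_gt0.
have r2 : 0 < Num.sqrt (1 - p2) by rewrite sqrtr_gt0 subr_gt0.
have y1 : 0 <= p1 / (1 - p1) by rewrite divr_ge0// subr_ge0 ltW.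
have y2 : 0 <= p2 / (1 - p2) by rewrite divr_ge0// subr_ge0 ltW.
have ry1 := sqrt_odds p11; have ry2 := sqrt_odds p21.
have Ka := @num_clusters_anti d V lambda; have Kd := @num_clusters_drop d V lambda.
have Ks := @num_clusters_step d V lambda.
have EI := @open_edges_setI d V lambda; have EU := @open_edges_setU d V lambda.
have ED := @card_open_edges_setD d V lambda.
have y_le : p1 <= p2 -> p1 / (1 - p1) <= p2 / (1 - p2) by move=> ?; exact: odds_mono.
split.
- case=> a12 p12 q12'; apply: stoch; apply: site_lattice_same_q => //.
    by rewrite q12' ler_wpM2l ?(ltW q20)// odds_mono.
  exact: y_le.
- move=> H; apply: stoch; apply: site_lattice_large_t => //.
  by move: H; rewrite /delta powRN powR_half_delta// ler_pdivrMr ?exprn_gt0.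
- case=> p12 q12' H; apply: stoch; apply: site_lattice_rc => //.
  + by move: H; rewrite /delta !powR_half_delta.
  + by apply: dilution_le ry1 ry2 (y_le p12).
  + by left; split=> //; exact: y_le.
(* The ratio condition is rewritten as one between the quotients [y / q] with [y = p / (1 - p)]. *)
- case=> q12' H; rewrite ![_ * (1 - _)]mulrC !invfM !mulrA => yq.
  apply: stoch; apply: site_lattice_rc => //.
  + by move: H; rewrite /delta !powR_half_delta.
  + apply: dilution_le ry1 ry2 _ => //.
    (* The order of the odds is derived here: [q2 / q1 >= 1], and the ratio condition bounds
       [q2 / q1] times the first odds by the second. *)
    apply: le_trans (_ : q2 / q1 * (p1 / (1 - p1)) <= _).
      by rewrite ler_peMl// ler_pdivlMr// mul1r.
    by rewrite -mulrA mulrC -ler_pdivlMr// mulrC.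
  + by right.
Qed.
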